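(* Let $m,n\in\mathbb{N}$ and let $\alpha_\pm=p_\pm q_\pm$, $\beta_\pm=p_\pm+q_\pm$ with $p_\pm,q_\pm\in(-1,1)$. For $\kappa\in\Lambda^{(m,n)}$ put $\tilde\xi_\kappa=(\vartheta_{\kappa_1},\dots,\vartheta_{\kappa_m})$. Then: (i) the spectrum of $\tilde H$ in $\ell^2(\Lambda^{(n,m)},\tilde\Delta)$ consists of the eigenvalues $\tilde E(\tilde\xi_\kappa)$, $\kappa\in\Lambda^{(m,n)}$, where $\tilde E(\xi)=2\sum_{1\le j\le m}\cos(\xi_j)$; (ii) the functions $\tilde\psi_{\tilde\xi_\kappa}$, $\kappa\in\Lambda^{(m,n)}$, form an orthogonal basis of $\ell^2(\Lambda^{(n,m)},\tilde\Delta)$ consisting of eigenfunctions of $\tilde H$, with $\tilde H\tilde\psi_{\tilde\xi_\kappa}=\tilde E(\tilde\xi_\kappa)\tilde\psi_{\tilde\xi_\kappa}$ for all $\kappa\in\Lambda^{(m,n)}$.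
   Context: $\Lambda^{(n,m)}=\{\mu\in\mathbb{Z}^n\mid m\ge\mu_1\ge\cdots\ge\mu_n\ge0\}$, $\Lambda^{(m,n)}=\{\lambda\in\mathbb{Z}^m\mid n\ge\lambda_1\ge\cdots\ge\lambda_m\ge0\}$; for $\mu\in\Lambda^{(n,m)}$ set $\mu_0\equiv m$, $\mu_{n+1}\equiv0$. Let $e_i$ be the standard unit vectors of $\mathbb{Z}^n$, $\delta_i=1$ if $i=0$ and $0$ otherwise. Operator: $(\tilde H\psi)(\mu)=\bigl(\beta_+(m-\mu_1)+\beta_-\mu_n\bigr)\psi(\mu)+\sum_{1\le i\le n,\ \mu+e_i\in\Lambda^{(n,m)}}(1-\alpha_+)^{\delta_{i-1}}(\mu_{i-1}-\mu_i)\psi(\mu+e_i)+\sum_{1\le i\le n,\ \mu-e_i\in\Lambda^{(n,m)}}(1-\alpha_-)^{\delta_{n-i}}(\mu_i-\mu_{i+1})\psi(\mu-e_i)$. Hilbert space: weights $\tilde\Delta_\mu=\frac{m!}{(1-\alpha_+)^{m-\mu_1}(1-\alpha_-)^{\mu_n}\prod_{0\le i\le n}(\mu_i-\mu_{i+1})!}$, inner product $\langle\psi,\phi\rangle_{\tilde\Delta}=\sum_{\mu\in\Lambda^{(n,m)}}\psi(\mu)\overline{\phi(\mu)}\tilde\Delta_\mu$. Conjugate partition: for $\mu\in\Lambda^{(n,m)}$, $\mu'\in\Lambda^{(m,n)}$ is the partition in which $i$ occurs exactly $\mu_i-\mu_{i+1}$ times ($i=0,\dots,n$). Wave functions: for $l\in\{0,\dots,n\}$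 and $\vartheta\notin\pi\mathbb{Z}$, $R_l(\vartheta)=\frac{1-\beta_+e^{-{\rm i}\vartheta}+\alpha_+e^{-2{\rm i}\vartheta}}{1-e^{-2{\rm i}\vartheta}}e^{{\rm i}l\vartheta}+\frac{1-\beta_+e^{{\rm i}\vartheta}+\alpha_+e^{2{\rm i}\vartheta}}{1-e^{2{\rm i}\vartheta}}e^{-{\rm i}l\vartheta}$; for $\lambda\in\Lambda^{(m,n)}$ and $\xi\in\mathbb{R}^m$ with all $\xi_j\notin\pi\mathbb{Z}$, $\tilde R_\lambda(\xi)=\sum_{\sigma\in S_m}R_{\lambda_1}(\xi_{\sigma(1)})\cdots R_{\lambda_m}(\xi_{\sigma(m)})$, and $\tilde\psi_\xi(\mu)=\tilde R_{\mu'}(\xi)$ for $\mu\in\Lambda^{(n,m)}$. Roots: with $v_a(z)=\int_0^z\frac{(1-a^2)dx}{1-2a\cos x+a^2}$ for $-1<a<1$, for $\texttt{k}\in\{0,1,\dots,n\}$ let $\vartheta_{\texttt{k}}\in(0,\pi)$ be the unique solution of $2n\vartheta+v_{p_+}(\vartheta)+v_{q_+}(\vartheta)+v_{p_-}(\vartheta)+v_{q_-}(\vartheta)=2\pi(\texttt{k}+1)$; then $0<\vartheta_0<\vartheta_1<\cdots<\vartheta_n<\pi$, and these are the roots in $(0,\pi)$ of the Askey-Wilson polynomial $p_{n+1}(\cos\vartheta;p_+,q_+,p_-,q_-\,|\,0)$ at base $0$. *)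

(* Defs.v *)
From HB Require Import structures.
From mathcomp Require Import all_boot all_order all_algebra.
From mathcomp Require Import all_classical all_reals all_analysis.
From mathcomp Require Import fingroup perm.
From mathcomp.real_closed Require Import complex.
Set Implicit Arguments.
Unset Strict Implicit.
Unset Printing Implicit Defensive.
Import Order.TTheory GRing.Theory Num.Theory.
Local Open Scope ring_scope.

Section Defs.
Variable R : realType.
Local Notation C := (R[i]).

Definition rC (x : R) : C := Complex x 0.
Definition expi (t : R) : C := Complex (cos t) (sin t).

Definition inLam (n m : nat) (s : seq int) : bool :=
  [&& size s == n, sorted (fun x y : int => y <= x) s & all (fun x : int => (0 <= x <= m%:Z)) s].

Definition lam_enum (n m : nat) : seq (seq int) :=
  [seq s <- [seq [seq (val x)%:Z | x <- val t] | t <- enum {: n.-tuple 'I_m.+1}]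
   | inLam n m s].

(* coordinates mu_i, 1 <= i <= n, with the conventions mu_0 = m, mu_{n+1} = 0 *)
Definition coord (n m : nat) (mu : seq int) (i : nat) : int :=
  if i == 0%N then m%:Z else if (i <= n)%N then nth 0 mu i.-1 else 0.

Definition unitv (n i : nat) : seq int := mkseq (fun j => ((j == i.-1) : nat)%:Z) n.
Definition addv (s t : seq int) : seq int := [seq x.1 + x.2 | x <- zip s t].
Definition subv (s t : seq int) : seq int := [seq x.1 - x.2 | x <- zip s t].

Variables (ap am bp bm : R).

Definition Hop (n m : nat) (psi : seq int -> C) (mu : seq int) : C :=
  rC (bp * (m%:Z - coord n m mu 1)%:~R + bm * (coord n m mu n)%:~R) * psi mu
  + \sum_(1 <= i < n.+1 | inLam n m (addv mu (unitv n i)))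
      rC ((1 - ap) ^+ (i.-1 == 0%N) * (coord n m mu i.-1 - coord n m mu i)%:~R)
      * psi (addv mu (unitv n i))
  + \sum_(1 <= i < n.+1 | inLam n m (subv mu (unitv n i)))
      rC ((1 - am) ^+ ((n - i)%N == 0%N) * (coord n m mu i - coord n m mu i.+1)%:~R)
      * psi (subv mu (unitv n i)).

Definition Delta (n m : nat) (mu : seq int) : R :=
  (m`!)%:R /
  ((1 - ap) ^+ absz (m%:Z - coord n m mu 1) * (1 - am) ^+ absz (coord n m mu n)
   * \prod_(i < n.+1) ((absz (coord n m mu i - coord n m mu i.+1))`!)%:R).

Definition inner (n m : nat) (psi phi : seq int -> C) : C :=
  \sum_(mu <- lam_enum n m) psi mu * conjc (phi mu) * rC (Delta n m mu).

(* conjugate partition mu' in Lambda^{(m,n)}: i occurs mu_i - mu_{i+1} times,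
   listed in nonincreasing order *)
Definition conjp (n m : nat) (mu : seq int) : seq nat :=
  flatten [seq nseq (absz (coord n m mu i - coord n m mu i.+1)) i | i <- rev (iota 0 n.+1)].

Definition Rl (l : nat) (t : R) : C :=
  (1 - rC bp * expi (- t) + rC ap * expi (- (2 * t))) / (1 - expi (- (2 * t)))
    * expi (l%:R * t)
  + (1 - rC bp * expi t + rC ap * expi (2 * t)) / (1 - expi (2 * t))
    * expi (- (l%:R * t)).

Definition Rtilde (m : nat) (lam : seq nat) (xi : 'I_m -> R) : C :=
  \sum_(s : 'S_m) \prod_(j < m) Rl (nth 0%N lam j) (xi (s j)).

Definition psit (n m : nat) (xi : 'I_m -> R) (mu : seq int) : C :=
  Rtilde (conjp n m mu) xi.

End Defs.

Definition Et {R : realType} (m : nat) (xi : 'I_m -> R) : R :=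
  2 * \sum_(j < m) cos (xi j).

Definition xit {R : realType} (m : nat) (theta : nat -> R) (kappa : seq int) : 'I_m -> R :=
  fun j => theta (absz (nth 0%R kappa j)).

Arguments xit {R} m theta kappa _.

Definition va {R : realType} (a z : R) : R :=
  Rintegral (@lebesgue_measure R) `[0, z]%classic
    (fun x => (1 - a ^+ 2) / (1 - 2 * a * cos x + a ^+ 2)).

(* spectrum of the operator Hop on the finite-dimensional space of functions on
   Lambda^{(n,m)}: z is in the spectrum iff Hop - z is not bijective there. *)
Definition in_spectrum {R : realType} (ap am bp bm : R) (n m : nat) (z : R[i]) : Prop :=
  ~ ((forall phi : seq int -> R[i], exists psi : seq int -> R[i],
        forall mu, inLam n m mu -> Hop ap am bp bm n m psi mu - z * psi mu = phi mu)
     /\ (forall psi : seq int -> R[i],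
          (forall mu, inLam n m mu -> Hop ap am bp bm n m psi mu - z * psi mu = 0) ->
          forall mu, inLam n m mu -> psi mu = 0)).

(* Main.v *)
(** The operator is the second quantization of a one-particle Jacobi operator on
    the sites 0, ..., n: if [mu] is read as the configuration of m bosons with
    [mu_i - mu_(i+1)] particles at site i, then [Hop] moves one particle at a
    time, and a function of [mu] is a symmetric function of words of length m
    over the sites. By the Poisson-kernel formula
      e^(i v_a(t)) = (e^(it) - a) / (1 - a e^(it)),
    the equation for [theta_k] says exactly that [R_l(theta_k)] satisfies the
    boundary relation at site n, so the waves [R_.(theta_k)], 0 <= k <= n, are
    one-particle eigenfunctions with distinct eigenvalues [2 cos theta_k]. They
    are therefore an orthogonal basis, and the symmetrized tensor powers of this
    basis are the functions [psi kappa]. Since the energies [Et] need not be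
    distinct, orthogonality and completeness are transported from the tensor
    basis rather than read off from the spectrum. *)
Require Import Defs.
From HB Require Import structures.
From mathcomp Require Import all_boot all_order all_algebra.
From mathcomp Require Import all_classical all_reals all_analysis.
From mathcomp Require Import fingroup perm.
From mathcomp.real_closed Require Import complex.
From mathcomp Require Import ring zify.
Import Order.TTheory GRing.Theory Num.Theory.
Import numFieldNormedType.Exports.
Local Open Scope ring_scope.

(** * The Poisson kernel and the phase e^(i v_a) *)

Section Phase.
Variable R : realType.
Implicit Types a t x z : R.

Let den_gt0 a x : -1 < a < 1 -> 0 < 1 - a * cos x.
Proof.
rewrite -ltr_norml subr_gt0 => ha; apply: le_lt_trans (ler_norm _) (le_lt_trans _ ha).
by rewrite normrM ler_piMr // ler_norml cos_geN1 cos_le1.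
Qed.

(** A continuous argument of e^(ix) (1 - a e^(-ix)) / (1 - a e^(ix)): the quotient contributes twice
    the argument of 1 - a e^(-ix), whose real part is positive for |a| < 1, so that [atan] has no
    branch jumps. *)
Definition poisson_phase a x := x + 2 * atan (a * sin x / (1 - a * cos x)).

Lemma is_derive_poisson_phase a x : -1 < a < 1 ->
  is_derive x 1 (poisson_phase a) ((1 - a ^+ 2) / (1 - 2 * a * cos x + a ^+ 2)).
Proof.
move=> ha; have d0 := den_gt0 a x ha.
have dne : 1 - a * cos x != 0 by rewrite gt_eqF.
have ds : is_derive x 1 (fun y => a * sin y) (a * cos x).
  by have := @is_deriveZ _ _ _ _ a _ _ _ (is_derive_sin x).
have dc : is_derive x 1 (fun y => (1 - a * cos y)) (a * sin x).
  have h := is_deriveB (is_derive_cst (1 : R) x 1)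
    (@is_deriveZ _ _ _ _ a _ _ _ (is_derive_cos x)).
  apply: (is_derive_eq h).
  by rewrite /GRing.scale /=; ring.
have dV : is_derive x 1 (fun y => (1 - a * cos y)^-1)
    (- (1 - a * cos x) ^- 2 *: (a * sin x)) by exact: is_deriveV.
have dq := is_deriveM ds dV.
have dat := @is_derive1_comp R atan
  (fun y => a * sin y * (1 - a * cos y)^-1) x _ _ (is_derive1_atan _) dq.
have h := is_deriveD (is_derive_id x 1) (@is_deriveZ _ _ _ _ 2 _ _ _ dat).
apply: (is_derive_eq h).
rewrite /GRing.scale /=.
have e := cos2Dsin2 x.
(* Both sides are |1 - a e^(ix)|^2; the sum of squares shows that the denominator is positive. *)
have h2 : 1 - 2 * a * cos x + a ^+ 2 = (1 - a * cos x) ^+ 2 + (a * sin x) ^+ 2.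
  by rewrite [in RHS]exprMn sin2cos2; ring.
have h2n : (1 - a * cos x) ^+ 2 + (a * sin x) ^+ 2 != 0.
  by rewrite gt_eqF // ltr_pwDl ?sqr_ge0 // exprn_gt0.
rewrite h2.
have -> : 1 - a ^+ 2 = 1 - a ^+ 2 * ((cos x) ^+ 2 + (sin x) ^+ 2) by rewrite e mulr1.
by field; rewrite dne h2n.
Qed.

Lemma va_poisson_phase a z : -1 < a < 1 -> 0 < z -> va a z = poisson_phase a z.
Proof.
move=> ha z0; rewrite /va /Rintegral.
have dG x : derivable (poisson_phase a) x 1.
  by apply: ex_derive; exact: is_derive_poisson_phase.
have cG x : {for x, continuous (poisson_phase a)}.
  by apply: differentiable_continuous; apply/derivable1_diffP.
rewrite (@continuous_FTC2 _ _ (poisson_phase a) 0 z z0) /=.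
- by rewrite /poisson_phase sin0 mulr0 mul0r atan0 mulr0 addr0 subr0.
- apply: continuous_subspaceT => x.
  have den x' : 0 < 1 - 2 * a * cos x' + a ^+ 2.
    have -> : 1 - 2 * a * cos x' + a ^+ 2 = (1 - a * cos x') ^+ 2 + (a * sin x') ^+ 2.
      by rewrite [in RHS]exprMn sin2cos2; ring.
    by rewrite ltr_pwDl ?sqr_ge0 // exprn_gt0 // den_gt0.
  apply: cvgM; first exact: cvg_cst.
  apply: cvgV; first by rewrite gt_eqF.
  apply: cvgD; last exact: cvg_cst.
  apply: cvgB; first exact: cvg_cst.
  by apply: cvgMr; exact: continuous_cos.
- split=> [x _ //||].
  + by apply: cvg_at_right_filter; exact: cG.
  + by apply: cvg_at_left_filter; exact: cG.
- move=> x _; rewrite derive1E.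
  by have := is_derive_poisson_phase a x ha => /@derive_val.
Qed.

Local Notation C := (R[i]).
Local Notation rC := (@rC R).

Lemma expiD (x y : R) : expi (x + y) = expi x * expi y.
Proof.
rewrite /expi sinD cosD; apply/eqP; rewrite eq_complex /= eqxx /=.
by apply/eqP; ring.
Qed.

Lemma expi0 : expi (0 : R) = 1.
Proof. by rewrite /expi sin0 cos0. Qed.

Lemma expiMn (x : R) k : expi (k%:R * x) = expi x ^+ k.
Proof.
elim: k => [|k IH]; first by rewrite mul0r expi0 expr0.
by rewrite -natr1 mulrDl mul1r expiD IH exprSr.
Qed.

Lemma expi_neq0 (x : R) : expi x != 0.
Proof.
apply/negP => /eqP e; have := expiD x (- x).
by rewrite subrr expi0 e mul0r => /eqP; rewrite oner_eq0.
Qed.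

Lemma expiN (x : R) : expi (- x) = (expi x)^-1.
Proof.
apply: (mulfI (expi_neq0 x)); rewrite -expiD subrr expi0 divff //.
exact: expi_neq0.
Qed.

Lemma expi_2pi k : expi (2 * pi * k%:R : R) = 1.
Proof.
rewrite mulrC expiMn.
have -> : expi (2 * pi : R) = 1.
  by rewrite /expi mulr_natl cos2pi sin2pi.
by rewrite expr1n.
Qed.

(** The Poisson-kernel formula without its denominator. With [u] the tangent of half the phase
    correction, 1 - a e^(iz) is a real multiple of 1 - iu, and e^(2i atan u) turns 1 - iu into 1 +
    iu. *)
Lemma expi_va a z : -1 < a < 1 -> 0 < z ->
  expi (va a z) * (1 - rC a * expi z) = expi z - rC a.
Proof.
move=> ha z0; rewrite va_poisson_phase // /poisson_phase expiD expiMn.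
have d0 := den_gt0 a z ha.
have dne : 1 - a * cos z != 0 by rewrite gt_eqF.
set u := a * sin z / (1 - a * cos z).
have cpos : 0 < cos (atan u).
  by apply: cos_gt0_pihalf; rewrite atan_gtNpi2 atan_ltpi2.
have su : sin (atan u) = u * cos (atan u).
  have := atanK u; rewrite /tan => h.
  by rewrite -[X in X * _]h divfK // gt_eqF.
have h1 := cos2Dsin2 (atan u).
have h2 := cos2Dsin2 z.
have hu : u * (1 - a * cos z) = a * sin z by rewrite /u divfK.
rewrite su in h1; rewrite /expi su.
move: (cos (atan u)) h1 => p h1.
have e1 : (1 - rC a * Complex (cos z) (sin z) : C)
    = rC (1 - a * cos z) * Complex 1 (- u).
  by apply/eqP; rewrite eq_complex /=; apply/andP; split; apply/eqP;
    [ring | transitivity (- (u * (1 - a * cos z))); [rewrite hu|]; ring].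
have e2 : (Complex p (u * p) : C) ^+ 2 * Complex 1 (- u) = Complex 1 u.
  apply/eqP; rewrite expr2 eq_complex /=; apply/andP; split; apply/eqP.
    by transitivity (p ^+ 2 + (u * p) ^+ 2); [ring | exact: h1].
  by transitivity (u * (p ^+ 2 + (u * p) ^+ 2)); [ring | rewrite h1 mulr1].
rewrite e1 mulrCA -mulrA [_ ^+ 2 * _]e2.
apply/eqP; rewrite eq_complex /=; apply/andP; split; apply/eqP.
  transitivity ((1 - a * cos z) * cos z - u * (1 - a * cos z) * sin z); first by ring.
  rewrite hu; transitivity (cos z - a * (cos z ^+ 2 + sin z ^+ 2)); first by ring.
  by rewrite h2 mulr1.
transitivity ((1 - a * cos z) * sin z + u * (1 - a * cos z) * cos z); first by ring.
by rewrite hu; ring.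
Qed.

(** The phase equation exponentiated: the total phase becomes 1, and the factors 1 - a e^(it) are
    multiplied out. *)
Lemma expi_bethe n (a b c d t : R) (k : nat) :
  -1 < a < 1 -> -1 < b < 1 -> -1 < c < 1 -> -1 < d < 1 -> 0 < t ->
  2 * n%:R * t + va a t + va b t + va c t + va d t = 2 * pi * k%:R ->
  let w := expi t in
  (w ^+ n) ^+ 2 * ((w - rC a) * (w - rC b) * (w - rC c) * (w - rC d))
  = (1 - rC a * w) * (1 - rC b * w) * (1 - rC c * w) * (1 - rC d * w).
Proof.
move=> ha hb hc hd t0 e w.
have := expi_2pi k; rewrite -e.
rewrite -!(expi_va _ _ _ t0) // -exprM -expiMn natrM [n%:R * 2]mulrC !expiD -/w => e1.
rewrite -[RHS]mul1r -e1; ring.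
Qed.
End Phase.

(** * Recurrence and boundary relations of the waves R_l *)

Section OneParticle.
Variable R : realType.
Local Notation C := (R[i]).
Local Notation rC := (@rC R).

Lemma rC_real_complex : rC = real_complex R.
Proof. by []. Qed.

Lemma conjc_rC x : conjc (rC x) = rC x.
Proof. exact: conjc_real. Qed.

Lemma conjc_expi (t : R) : conjc (expi t) = expi (- t).
Proof. by rewrite /expi cosN sinN. Qed.

Lemma rC_2cos (t : R) : rC (2 * cos t) = expi t + (expi t)^-1.
Proof.
rewrite -expiN /expi cosN sinN; apply/eqP; rewrite eq_complex /=.
by rewrite subrr eqxx andbT mulr2n mulrDl mul1r.
Qed.

Lemma sqr_expi_neq1 (t : R) : 0 < t < pi -> 1 - expi t ^+ 2 != 0.
Proof.
move=> /sin_gt0_pi s0; apply/negP => /eqP e.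
have h2 := cos2Dsin2 t.
(* Here 1 - e^(2it) = 2 sin t (sin t - i cos t), and sin t > 0 on (0, pi). *)
have : rC (sin t * 2) * Complex (sin t) (- cos t) = 0.
  rewrite -[RHS]e expr2; apply/eqP; rewrite eq_complex /=.
  apply/andP; split; apply/eqP; last by ring.
  by rewrite -[X in _ = X - _]h2; ring.
move/eqP; rewrite mulf_eq0 !eq_complex /= eqxx andbT.
by rewrite mulf_eq0 pnatr_eq0 orbF (gt_eqF s0).
Qed.

Section Wave.
Variables (a b : R) (t : R).
Hypothesis ht : 0 < t < pi.
Let w : C := expi t.
Let w0 : w != 0. Proof. exact: expi_neq0. Qed.
Let w2 : 1 - w ^+ 2 != 0. Proof. exact: sqr_expi_neq1. Qed.

(** In this form, rational in w = e^(it), the recurrences below become identities for [field]. *)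
Lemma RlE l : Rl a b l t = (w ^+ 2 - rC b * w + rC a) / (w ^+ 2 - 1) * w ^+ l
  + (1 - rC b * w + rC a * w ^+ 2) / (1 - w ^+ 2) / w ^+ l.
Proof.
rewrite /Rl !expiN !expiMn -/w; congr (_ * _ + _).
have w2' : w ^+ 2 - 1 != 0 by rewrite -opprB oppr_eq0.
by field; rewrite w0 w2'.
Qed.

(** Conjugation exchanges the two terms of R_l. *)
Lemma conjc_Rl l : conjc (Rl a b l t) = Rl a b l t.
Proof.
pose J : {rmorphism C -> C} := @conjc R; change (J (Rl a b l t) = Rl a b l t).
have JrC x : J (rC x) = rC x by exact: conjc_rC.
have Jexpi x : J (expi x) = expi (- x) by exact: conjc_expi.
rewrite /Rl !(rmorphM, rmorphD, fmorphV, rmorph1) !rmorphN !rmorphM.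
by rewrite !Jexpi !JrC !opprK addrC.
Qed.

(** This value is the same for all t and nonzero for a < 1; it later witnesses that the waves do not
    vanish. *)
Lemma Rl0 : Rl a b 0 t = rC (1 - a).
Proof.
rewrite RlE expr0 invr1 !mulr1 rC_real_complex rmorphB rmorph1.
have w2' : w ^+ 2 - 1 != 0 by rewrite -opprB oppr_eq0.
by field; rewrite w2 w2'.
Qed.

(** The boundary relation at site 0. The numerators of R_l are built so that it holds for every t in
    (0, pi); only the relation at site n restricts t. *)
Lemma Rl_rec0 : rC (1 - a) * Rl a b 1 t + rC b * Rl a b 0 t
  = rC (2 * cos t) * Rl a b 0 t.
Proof.
rewrite !RlE expr0 expr1 rC_2cos -/w rC_real_complex rmorphB rmorph1.
have w2' : w ^+ 2 - 1 != 0 by rewrite -opprB oppr_eq0.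
by field; rewrite w0 w2 w2'.
Qed.

Lemma Rl_rec l : Rl a b l.+2 t + Rl a b l t = rC (2 * cos t) * Rl a b l.+1 t.
Proof.
rewrite !RlE !exprS rC_2cos -/w.
have w2' : w ^+ 2 - 1 != 0 by rewrite -opprB oppr_eq0.
by field; rewrite w0 w2 w2' expf_neq0.
Qed.

End Wave.

Lemma Rl_rec_last (pp qp pm qm t : R) n : 0 < t < pi ->
  -1 < pp < 1 -> -1 < qp < 1 -> -1 < pm < 1 -> -1 < qm < 1 -> (0 < n)%N ->
  (exists k, 2 * n%:R * t + va pp t + va qp t + va pm t + va qm t = 2 * pi * k%:R) ->
  rC (1 - pm * qm) * Rl (pp * qp) (pp + qp) n.-1 t
  + rC (pm + qm) * Rl (pp * qp) (pp + qp) n t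
  = rC (2 * cos t) * Rl (pp * qp) (pp + qp) n t.
Proof.
move=> ht hpp hqp hpm hqm; case: n => // n _ [k hk].
have t0 : 0 < t by case/andP: ht.
have := @expi_bethe _ n.+1 _ _ _ _ _ _ hpp hqp hpm hqm t0 hk.
have w0 := expi_neq0 _ t; have w2 := sqr_expi_neq1 t ht.
rewrite /= !RlE // rC_2cos; move: (expi t) w0 w2 => w w0 w2.
rewrite [w ^+ n.+1]exprS; have := expf_neq0 n w0; move: (w ^+ n) => y y0.
rewrite rC_real_complex !(rmorphB, rmorphM, rmorphD, rmorph1) /=.
move: (_ pp) (_ qp) (_ pm) (_ qm) => P Q P' Q' e.
have w2' : w ^+ 2 - 1 != 0 by rewrite -opprB oppr_eq0.
set B := (X in _ = X) in e; set A := (X in X = _) in e.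
apply/eqP; rewrite -subr_eq0; apply/eqP.
(* The defect of the boundary relation at site n is a multiple of the defect [B - A] of the
   exponentiated phase equation. *)
transitivity ((B - A) / (w * (w * y) * (w ^+ 2 - 1))); last by rewrite e subrr mul0r.
by rewrite /A /B; field; rewrite w0 w2 w2' y0.
Qed.

End OneParticle.

(** * The one-particle Jacobi operator and its symmetry *)

Section Jacobi.
Variable R : realType.
Local Notation C := (R[i]).
Local Notation rC := (@rC R).
Variables (ap am bp bm : R) (n : nat).
Hypotheses (hap : ap < 1) (ham : am < 1).
Implicit Types f g : nat -> C.

Definition hop_diag (l : nat) : C := rC (bp *+ (l == 0%N) + bm *+ (l == n)).
(** Zero at the last site, as [hop_down] is at site 0, so that [f n.+1] and the truncated [f 0.-1]
    do not contribute to [jacobi]. *)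
Definition hop_up (l : nat) : C :=
  if (l < n)%N then rC ((1 - ap) ^+ (l == 0%N)) else 0.
Definition hop_down (l : nat) : C :=
  if (0 < l)%N then rC ((1 - am) ^+ (l == n)) else 0.

(** [Hop] for m = 1, the partition [(1^l, 0^(n-l))] being encoded by [l]. *)
Definition jacobi f (l : nat) : C :=
  hop_diag l * f l + hop_up l * f l.+1 + hop_down l * f l.-1.

(** The one-particle form of [Delta]. Detailed balance holds across each edge with l < n:
    [weight l * hop_up l] and [weight l.+1 * hop_down l.+1] both equal 1. *)
Definition weight (l : nat) : R :=
  ((1 - ap) ^+ (l == 0%N) * (1 - am) ^+ (l == n))^-1.

Lemma weight_gt0 l : 0 < weight l.
Proof. by rewrite invr_gt0 mulr_gt0 // exprn_gt0 // subr_gt0. Qed.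

Lemma weight_up l : (l < n)%N -> rC (weight l) * hop_up l = 1.
Proof.
move=> ln; rewrite /hop_up ln /weight (ltn_eqF ln) expr0 mulr1 rC_real_complex.
by rewrite -rmorphM mulVf ?rmorph1 // expf_neq0 // gt_eqF // subr_gt0.
Qed.

Lemma weight_down l : (l < n)%N -> rC (weight l.+1) * hop_down l.+1 = 1.
Proof.
move=> ln; rewrite /hop_down /weight /= expr0 mul1r rC_real_complex.
by rewrite -rmorphM mulVf ?rmorph1 // expf_neq0 // gt_eqF // subr_gt0.
Qed.

(** Bilinear, without conjugation: it is applied to real-valued waves, for which it agrees with the
    Hermitian product. *)
Definition inner1 f g : C := \sum_(l < n.+1) rC (weight l) * (f l * g l).

(** By detailed balance every edge has coefficient 1, which makes the form visibly symmetric in f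
    and g. *)
Lemma inner1_jacobi f g : inner1 (jacobi f) g =
  \sum_(l < n.+1) rC (weight l) * hop_diag l * (f l * g l)
  + \sum_(l < n) (f l.+1 * g l + f l * g l.+1).
Proof.
rewrite /inner1 /jacobi.
under eq_bigr => l _ do rewrite !mulrDl !mulrDr -!mulrA -addrA.
rewrite big_split /=; congr (_ + _).
  by apply: eq_bigr => l _; rewrite !mulrA.
rewrite !big_split /=; congr (_ + _).
  rewrite big_ord_recr /= [X in _ + X](_ : _ = 0) ?addr0.
    by apply: eq_bigr => l _; rewrite mulrA weight_up //= mul1r.
  by rewrite /hop_up ltnn mul0r mulr0.
rewrite big_ord_recl /= [X in X + _](_ : _ = 0) ?add0r.
  by apply: eq_bigr => l _; rewrite mulrA weight_down //= mul1r.
by rewrite /hop_down mul0r mulr0.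
Qed.

Lemma jacobi_sym f g : inner1 (jacobi f) g = inner1 f (jacobi g).
Proof.
have e : inner1 f (jacobi g) = inner1 (jacobi g) f.
  by apply: eq_bigr => l _; rewrite [f l * _]mulrC.
rewrite e !inner1_jacobi; congr (_ + _); apply: eq_bigr => l _.
  by rewrite [f l * _]mulrC.
by rewrite addrC [f l * _]mulrC [f l.+1 * _]mulrC.
Qed.

Lemma eigen_orthogonal f g x y : x != y ->
  (forall l, (l <= n)%N -> jacobi f l = x * f l) ->
  (forall l, (l <= n)%N -> jacobi g l = y * g l) -> inner1 f g = 0.
Proof.
move=> xy ef eg; apply/eqP; move: (jacobi_sym f g).
have -> : inner1 (jacobi f) g = x * inner1 f g.
  rewrite /inner1 mulr_sumr; apply: eq_bigr => l _; rewrite ef ?leq_ord //.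
  by ring.
have -> : inner1 f (jacobi g) = y * inner1 f g.
  rewrite /inner1 mulr_sumr; apply: eq_bigr => l _; rewrite eg ?leq_ord //.
  by ring.
move/eqP; rewrite -subr_eq0 -mulrBl mulf_eq0 subr_eq0 (negPf xy) //.
Qed.

Lemma inner1_gt0 f : (forall l, conjc (f l) = f l) -> f 0%N != 0 ->
  0 < inner1 f f.
Proof.
move=> rf f0.
have w0 l : 0 < rC (weight l) by rewrite rC_real_complex ltcR weight_gt0.
have ff l : 0 <= f l * f l by rewrite -{2}rf; exact: mulcJ_ge0.
rewrite /inner1 big_ord_recl /=; apply: ltr_pwDl.
  by rewrite mulr_gt0 // lt_def mulf_neq0 // ff.
by apply: sumr_ge0 => l _; rewrite mulr_ge0 // ltW.
Qed.

End Jacobi.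

(** * Solutions of the phase equation give one-particle eigenfunctions *)

Section BetheWave.
Variable R : realType.
Local Notation rC := (@rC R).
Variables (pp qp pm qm t : R) (n : nat).
Hypotheses (hpp : -1 < pp < 1) (hqp : -1 < qp < 1).
Hypotheses (hpm : -1 < pm < 1) (hqm : -1 < qm < 1).
Hypotheses (hn : (0 < n)%N) (ht : 0 < t < pi).
Hypothesis hbethe : exists k,
  2 * n%:R * t + va pp t + va qp t + va pm t + va qm t = 2 * pi * k%:R.

(** Site 0, site n and the interior each have their own relation; n > 0 keeps the two ends apart. *)
Lemma jacobi_Rl l : (l <= n)%N ->
  jacobi R (pp * qp) (pm * qm) (pp + qp) (pm + qm) n
    (fun i => Rl (pp * qp) (pp + qp) i t) l
  = rC (2 * cos t) * Rl (pp * qp) (pp + qp) l t.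
Proof.
rewrite /jacobi /hop_diag /hop_up /hop_down.
case: l => [_|l].
  rewrite hn eqxx (ltn_eqF hn) /= mulr1n mulr0n addr0 mul0r addr0 expr1 addrC.
  exact: Rl_rec0.
rewrite leq_eqVlt => /predU1P[ln|ln].
  rewrite -ln ltnn eqxx /= mulr0n add0r mulr1n mul0r addr0 expr1 addrC.
  by have := Rl_rec_last R pp qp pm qm t n ht hpp hqp hpm hqm hn hbethe; rewrite -ln.
rewrite ln (ltn_eqF ln) /= !mulr0n add0r !expr0 rC_real_complex rmorph0 rmorph1.
by rewrite mul0r add0r !mul1r Rl_rec.
Qed.

End BetheWave.

(** * Counting the rearrangements of a word *)

Section Permutations.
Variable T : finType.
Implicit Types s : seq T.

Lemma sum_count_mem s : (\sum_(a : T) count_mem a s = size s)%N.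
Proof.
elim: s => [|b s IH] /=; first by rewrite big1.
rewrite big_split /= IH (bigD1 b) //= eqxx big1 // => a ab.
by rewrite eq_sym (negPf ab).
Qed.

(** The multinomial formula, by induction on the length: rearrangements are classified by their
    first letter x, and the rest rearranges s with one x removed. *)
Lemma size_permutations_count s :
  (size (permutations s) * \prod_(a : T) (count_mem a s)`! = (size s)`!)%N.
Proof.
have [k] := ubnP (size s); elim: k s => // k IH s.
case: (posnP (size s)) => [/size0nil -> _|s0 sk].
  by rewrite /= big1_eq.
rewrite (perm_size (permutationsE s0)) size_allpairs_dep sumnE big_map.
rewrite big_distrl /= big_uniq ?undup_uniq //=.
have -> : ((size s)`! = \sum_(x : T) count_mem x s * (size s).-1`!)%N.
  by rewrite -big_distrl sum_count_mem -[in LHS](prednK s0) factS prednK.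
rewrite [RHS](bigID [in s]) /= [X in (_ + X)%N]big1 ?addn0; last first.
  by move=> x /count_memPn ->.
apply: eq_big => [x|x]; rewrite mem_undup // => xs.
have c0 : (0 < count_mem x s)%N by rewrite -has_count has_pred1.
rewrite -(size_rem xs) -IH ?size_rem //; last by rewrite prednK.
rewrite [in LHS](bigD1 x) //= [in RHS](bigD1 x) //= !mulnA; congr (_ * _)%N.
  rewrite count_rem xs /= eqxx subn1.
  by case: (count_mem x s) c0 => // c _; rewrite factS /=; ring.
apply: eq_bigr => y yx; rewrite count_rem /= [x == y]eq_sym (negPf yx).
by rewrite andbF subn0.
Qed.
End Permutations.

(** * Partitions as words up to permutation *)

Section Words.
Local Notation coord := Defs.coord.
Local Notation addv := Defs.addv.
Local Notation subv := Defs.subv.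
Variables (m n : nat).
Implicit Types (x y : {ffun 'I_m -> 'I_n.+1}) (mu nu : seq int).

(** A word [x] lists the sites of the m particles. This count is the part mu_i of its partition, and
    [at_exactly] is the occupation number mu_i - mu_(i+1). *)
Definition at_least x (i : nat) : nat := \sum_(j < m) (i <= x j)%N.
Definition at_exactly x (i : nat) : nat := \sum_(j < m) (x j == i :> nat).

(** The partition [mu] whose conjugate [mu'] lists the letters of [x]. *)
Definition profile x : seq int := mkseq (fun i => (at_least x i.+1)%:Z) n.

Lemma at_least0 x : at_least x 0 = m.
Proof. by rewrite /at_least sum_nat_const card_ord muln1. Qed.

Lemma at_least_oversize x : at_least x n.+1 = 0%N.
Proof. by apply: big1 => j _; rewrite leqNgt ltn_ord. Qed.

Lemma at_least_split x i : at_least x i = (at_exactly x i + at_least x i.+1)%N.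
Proof.
rewrite -big_split; apply: eq_bigr => j _ /=.
by rewrite [in LHS]leq_eqVlt eq_sym; case: ltngtP.
Qed.

Lemma coord0 mu : coord n m mu 0 = m%:Z. Proof. by []. Qed.

Lemma coord_last mu : coord n m mu n.+1 = 0.
Proof. by rewrite /coord /= ltnn. Qed.

Lemma coordS mu i : (i < n)%N -> coord n m mu i.+1 = nth 0 mu i.
Proof. by move=> lt_in; rewrite /coord /= lt_in. Qed.

Lemma coord_profile x i : (i <= n.+1)%N -> coord n m (profile x) i = (at_least x i)%:Z.
Proof.
case: i => [_|i]; first by rewrite at_least0.
rewrite ltnS leq_eqVlt => /predU1P[->|lt_in].
  by rewrite coord_last at_least_oversize.
by rewrite coordS // nth_mkseq.
Qed.

Lemma coord_profileB x i : (i <= n)%N ->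
  coord n m (profile x) i - coord n m (profile x) i.+1 = (at_exactly x i)%:Z.
Proof.
move=> le_in; rewrite !coord_profile // ?leqW // at_least_split.
by rewrite PoszD addrK.
Qed.

Lemma profile_in_Lam x : inLam n m (profile x).
Proof.
rewrite /inLam size_mkseq eqxx /=; apply/andP; split.
  apply/(sortedP 0) => i; rewrite size_mkseq => lt_in.
  rewrite !nth_mkseq ?(ltnW lt_in) // lez_nat.
  by rewrite [leqRHS]at_least_split leq_addl.
apply/allP => _ /mapP[i _ ->]; rewrite lez_nat -[leqRHS](at_least0 x).
by apply: leq_sum => j _; case: leqP.
Qed.

Lemma Lam_size mu : inLam n m mu -> size mu = n.
Proof. by case/and3P => /eqP. Qed.

Lemma Lam_coord mu i : inLam n m mu -> (i <= n)%N ->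
  0 <= coord n m mu i.+1 <= coord n m mu i.
Proof.
move=> /and3P[/eqP sz srt /allP al] le_in.
have bd j : (j < n)%N -> 0 <= nth 0 mu j <= m%:Z.
  by move=> lt_jn; apply: al; rewrite mem_nth ?sz.
have nn j : (j <= n)%N -> 0 <= coord n m mu j.
  by case: j => // j lt_jn; rewrite coordS //; case/andP: (bd j lt_jn).
move: le_in; rewrite leq_eqVlt => /predU1P[->|lt_in].
  by rewrite coord_last lexx nn.
rewrite nn //=; case: i lt_in => [|i] lt_in.
  by rewrite coordS //; case/andP: (bd 0%N lt_in).
rewrite !coordS ?(ltnW lt_in) //.
by apply: (sortedP 0 srt); rewrite sz.
Qed.

Lemma eq_Lam mu nu : size mu = n -> size nu = n ->
  (forall i, (0 < i <= n)%N -> coord n m mu i = coord n m nu i) -> mu = nu.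
Proof.
move=> smu snu e; apply: (@eq_from_nth _ 0); rewrite ?smu ?snu // => i lt_in.
by have := e i.+1 lt_in; rewrite !coordS.
Qed.

(** Exactly mu_j - mu_(j+1) entries of mu' equal j, so the number of entries that are at least i
    telescopes to mu_i. *)
Lemma count_conjp mu i : inLam n m mu -> (i <= n.+1)%N ->
  (count (leq i) (conjp n m mu))%:Z = coord n m mu i.
Proof.
move=> hmu le_in; rewrite /conjp count_flatten -map_comp sumnE big_map.
rewrite (perm_big _ (permEl (perm_rev _))) -[iota 0 n.+1]/(index_iota 0 n.+1).
rewrite (@big_cat_nat _ _ _ i) //= big_nat big1 ?add0n; last first.
  by move=> j /andP[_ ji] /=; rewrite count_nseq leqNgt ji.
rewrite (big_morph Posz PoszD (erefl _)) big_nat.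
transitivity (\sum_(i <= j < n.+1) (coord n m mu j - coord n m mu j.+1)).
  rewrite [RHS]big_nat; apply: eq_bigr => j /andP[ij jn].
  rewrite /= count_nseq ij mul1n gez0_abs // subr_ge0.
  by case/andP: (Lam_coord _ j hmu jn).
rewrite (telescope_sumr_eq (fun j => - coord n m mu j)) //.
  by rewrite coord_last oppr0 add0r opprK.
by move=> j _; rewrite addrC opprK.
Qed.

Lemma size_conjp mu : inLam n m mu -> size (conjp n m mu) = m.
Proof.
move=> hmu; have := count_conjp mu 0 hmu isT.
rewrite coord0 => -[]; rewrite (@eq_count _ _ predT) // count_predT; exact.
Qed.

Lemma conjp_leq mu j : (nth 0%N (conjp n m mu) j <= n)%N.
Proof.
have [lt_j|] := ltnP j (size (conjp n m mu)); last by move=> h; rewrite nth_default.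
have /flatten_mapP[a] := mem_nth 0%N lt_j.
by rewrite mem_rev mem_iota => /andP[_ lt_in] /nseqP[-> _].
Qed.

(** A section of [profile] on Lambda. The entries of mu' are at most n, so [inord] never takes its
    default value. *)
Definition word mu : {ffun 'I_m -> 'I_n.+1} :=
  [ffun j : 'I_m => inord (nth 0%N (conjp n m mu) j)].

Lemma wordE mu j : word mu j = nth 0%N (conjp n m mu) j :> nat.
Proof. by rewrite ffunE inordK // ltnS conjp_leq. Qed.

Lemma wordK mu : inLam n m mu -> profile (word mu) = mu.
Proof.
move=> hmu; apply: eq_Lam; rewrite ?size_mkseq ?(Lam_size _ hmu) //.
move=> i /andP[_ le_in]; rewrite coord_profile ?leqW // -count_conjp ?leqW //.
congr Posz; rewrite -sum1_count big_mkcond (big_nth 0%N) size_conjp // big_mkord.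
by apply: eq_bigr => j _; rewrite wordE; case: leqP.
Qed.

Lemma profile_at_exactly x y i :
  profile x = profile y -> at_exactly x i = at_exactly y i.
Proof.
move=> e; have [le_in|lt_ni] := leqP i n.
  by apply/eqP; rewrite -eqz_nat -!coord_profileB // e.
by rewrite /at_exactly !big1 // => j _; rewrite (ltn_eqF (leq_trans (ltn_ord _) lt_ni)).
Qed.

Lemma count_codom x (a : 'I_n.+1) : count_mem a (codom x) = at_exactly x a.
Proof.
by rewrite count_map -sum1_count big_mkcond /= big_enum.
Qed.

Lemma perm_codom x y : perm_eq (codom x) (codom y) = (profile x == profile y).
Proof.
apply/idP/eqP => [/seq.permP e|e]; last first.
  by apply/allP => a _ /=; rewrite !count_codom (profile_at_exactly x y).
have count_le z i : at_least z i = count (fun a : 'I_n.+1 => i <= a)%N (codom z).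
  rewrite count_map -sum1_count big_mkcond /= big_enum.
  by apply: eq_bigr => j _; case: leqP.
by apply: eq_mkseq => i; rewrite !count_le e.
Qed.

(** The fibres of [profile] are the orbits of S_m; hence functions of mu correspond to symmetric
    functions of words. *)
Lemma eq_profileP x y :
  reflect (exists s : 'S_m, x = [ffun j => y (s j)]) (profile x == profile y).
Proof.
rewrite -perm_codom.
apply: (iffP (@tuple_permP _ m _ [tuple y j | j < m])) => -[s es]; exists s.
  apply/ffunP => j; rewrite ffunE.
  have := congr1 (fun r => nth (x j) r j) es.
  by rewrite -[codom x]/(tval [tuple x j0 | j0 < m]) -!tnth_nth !tnth_mktuple.
by apply: eq_codom => j; rewrite es ffunE tnth_mktuple.
Qed.

Definition upd x (j : 'I_m) (v : 'I_n.+1) : {ffun 'I_m -> 'I_n.+1} :=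
  [ffun l => if l == j then v else x l].

Lemma at_least_upd x j (v : 'I_n.+1) i :
  (at_least (upd x j v) i + (i <= x j) = at_least x i + (i <= v))%N.
Proof.
rewrite /at_least (bigD1 j) //= [in RHS](bigD1 j) //= ffunE eqxx.
rewrite (eq_bigr (fun l => (i <= x l : nat))%N); first by ring.
by move=> l lj; rewrite ffunE (negPf lj).
Qed.

Lemma size_unitv i : size (unitv n i) = n.
Proof. exact: size_mkseq. Qed.

Lemma coord_addv mu i k : size mu = n -> (0 < k <= n)%N ->
  coord n m (addv mu (unitv n i.+1)) k = coord n m mu k + (k == i.+1)%:R.
Proof.
case: k => // k smu /andP[_ lt_kn]; rewrite !coordS //.
rewrite (nth_map (0, 0)) ?size_zip ?smu ?size_unitv ?minnn //.
by rewrite nth_zip ?smu ?size_unitv //= nth_mkseq // eqSS natz.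
Qed.

Lemma coord_subv mu i k : size mu = n -> (0 < k <= n)%N ->
  coord n m (subv mu (unitv n i.+1)) k = coord n m mu k - (k == i.+1)%:R.
Proof.
case: k => // k smu /andP[_ lt_kn]; rewrite !coordS //.
rewrite (nth_map (0, 0)) ?size_zip ?smu ?size_unitv ?minnn //.
by rewrite nth_zip ?smu ?size_unitv //= nth_mkseq // eqSS natz.
Qed.

(** A particle that moves from site l to l + 1 affects only the count of particles at sites at least
    l + 1. *)
Lemma profile_up x j (v : 'I_n.+1) : v = (x j).+1 :> nat ->
  profile (upd x j v) = addv (profile x) (unitv n v).
Proof.
move=> ev; rewrite [in unitv _ _]ev; apply: eq_Lam.
- exact: size_mkseq.
- by rewrite size_map size_zip size_unitv size_mkseq minnn.
move=> k /andP[k0 kn]; rewrite coord_addv ?size_mkseq ?k0 //.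
rewrite !coord_profile ?leqW //; have := at_least_upd x j v k.
rewrite ev [(k <= (x j).+1)%N]leq_eqVlt ltnS natz.
case: eqVneq => [->|_] /=; first by rewrite ltnn; lia.
by case: (k <= _)%N => /=; lia.
Qed.

Lemma profile_down x j (v : 'I_n.+1) : x j = v.+1 :> nat ->
  profile (upd x j v) = subv (profile x) (unitv n (x j)).
Proof.
move=> ev; rewrite [in unitv _ _]ev; apply: eq_Lam.
- exact: size_mkseq.
- by rewrite size_map size_zip size_unitv size_mkseq minnn.
move=> k /andP[k0 kn]; rewrite coord_subv ?size_mkseq ?k0 //.
rewrite !coord_profile ?leqW //; have := at_least_upd x j v k.
rewrite ev [(k <= v.+1)%N]leq_eqVlt ltnS natz.
case: eqVneq => [->|_] /=; first by rewrite ltnn; lia.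
by case: (k <= _)%N => /=; lia.
Qed.

(** The words in the fibre are the distinct rearrangements of [y], counted by a multinomial
    coefficient. *)
Lemma card_profile y :
  (#|[set x | profile x == profile y]| * \prod_(i < n.+1) (at_exactly y i)`! = m`!)%N.
Proof.
have <- : size (permutations (codom y)) = #|[set x | profile x == profile y]|.
  rewrite cardE -(size_map (fun x : {ffun 'I_m -> 'I_n.+1} => codom x)).
  apply: perm_size.
  apply: uniq_perm; rewrite ?permutations_uniq //.
    rewrite map_inj_uniq ?enum_uniq // => x x' /eq_in_map e.
    by apply/ffunP => j; apply: e; rewrite mem_enum.
  move=> t; rewrite mem_permutations; apply/idP/mapP => [pt|[x]]; last first.
    by rewrite mem_enum inE -perm_codom => ? ->.
  have st : size t = m by rewrite (perm_size pt) size_codom card_ord.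
  have et : t = codom [ffun j : 'I_m => nth ord0 t j].
    apply: (@eq_from_nth _ ord0); rewrite st ?size_codom ?card_ord // => i lt_im.
    by rewrite (nth_map (Ordinal lt_im)) ?size_enum_ord // ffunE nth_enum_ord.
  by eexists; last exact: et; rewrite mem_enum inE -perm_codom -et.
have := size_permutations_count _ (codom y).
rewrite size_codom card_ord => <-; congr (_ * _)%N.
by apply: eq_bigr => a _; rewrite count_codom.
Qed.

End Words.

(** * Symmetrized tensor products *)

Section SymmetrizedProduct.
Variables (K : comNzRingType) (m n : nat).
Implicit Types (f : 'I_m -> nat -> K) (x : {ffun 'I_m -> 'I_n.+1}).

(** The permanent of the matrix with entries [f i (x j)]: the tensor product of the [f i],
    symmetrized without normalization. *)
Definition symprod f x : K := \sum_(s : 'S_m) \prod_(j < m) f (s j) (x j).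

Lemma symprod_permr f x (t : 'S_m) : symprod f [ffun j => x (t j)] = symprod f x.
Proof.
rewrite /symprod [RHS](reindex_inj (mulgI t^-1)%g); apply: eq_bigr => s _.
rewrite [RHS](reindex_inj (@perm_inj _ t)); apply: eq_bigr => j _.
by rewrite ffunE permM permK.
Qed.

Lemma symprod_perml f x (t : 'S_m) : symprod (fun i => f (t i)) x = symprod f x.
Proof.
rewrite /symprod [RHS](reindex_inj (mulIg t)); apply: eq_bigr => s _.
by apply: eq_bigr => j _; rewrite permM.
Qed.

Lemma symprod_profile f x y :
  profile m n x = profile m n y -> symprod f x = symprod f y.
Proof. by move/eqP/eq_profileP => [s ->]; rewrite symprod_permr. Qed.

Lemma symprod_upd f x j v : symprod f (upd m n x j v) =
  \sum_(s : 'S_m) f (s j) v * \prod_(l < m | l != j) f (s l) (x l).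
Proof.
apply: eq_bigr => s _; rewrite (bigD1 j) //= ffunE eqxx; congr (_ * _).
by apply: eq_bigr => l lj; rewrite ffunE (negPf lj).
Qed.

(** A sum over words of a product over particles factorizes into sums over sites; each pair of
    permutations leaves a product of one-particle inner products. *)
Lemma sum_symprod2 f g (w : nat -> K) :
  \sum_x symprod f x * symprod g x * \prod_(j < m) w (x j)
  = \sum_(s : 'S_m) \sum_(t : 'S_m)
      \prod_(j < m) \sum_(l < n.+1) w l * (f (s j) l * g (t j) l).
Proof.
under eq_bigr => x _ do rewrite /symprod big_distrlr /= mulr_suml.
rewrite exchange_big /=; apply: eq_bigr => s _.
under eq_bigr => x _ do rewrite mulr_suml.
rewrite exchange_big /=; apply: eq_bigr => t _.
rewrite bigA_distr_bigA /=; apply: eq_bigr => x _.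
by rewrite !big_split /= mulrC.
Qed.

(** The tensor power of an inverse matrix inverts the tensor power: the sum over k factorizes into
    Kronecker deltas, and only y = x survives. *)
Lemma tensor_inversion (V U : nat -> nat -> K) (F : {ffun 'I_m -> 'I_n.+1} -> K) x :
  (forall l l', (l <= n)%N -> (l' <= n)%N ->
     \sum_(k < n.+1) V k l * U k l' = (l == l')%:R) ->
  F x = \sum_(k : {ffun 'I_m -> 'I_n.+1})
     (\sum_y F y * \prod_(j < m) U (k j) (y j)) * \prod_(j < m) V (k j) (x j).
Proof.
move=> VU; under eq_bigr => k _ do rewrite mulr_suml.
rewrite exchange_big /= (bigD1 x) //= [X in _ + X]big1 ?addr0 => [|y yx].
  under eq_bigr => k _ do rewrite -mulrA [X in _ * X]mulrC -big_split /=.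
  rewrite -mulr_sumr
    -(bigA_distr_bigA (fun j (k : 'I_n.+1) => V k (x j) * U k (x j))) /=.
  by rewrite big1 ?mulr1 // => j _; rewrite VU ?eqxx // -ltnS.
under eq_bigr => k _ do rewrite -mulrA [X in _ * X]mulrC -big_split /=.
rewrite -mulr_sumr
    -(bigA_distr_bigA (fun j (k : 'I_n.+1) => V k (x j) * U k (y j))) /=.
have [j xyj] : exists j, x j != y j.
  apply/existsP; apply: contraNT yx => /existsPn e.
  by apply/eqP/ffunP => j; apply/eqP; rewrite eq_sym; apply: contraNT (e j) => ->.
rewrite (bigD1 j) //= VU -1?ltnS // -val_eqE /= in xyj *.
by rewrite (negPf xyj) mul0r mulr0.
Qed.

(** As [phi (profile m n x)] is invariant under permuting the letters of x, adding its m! expansions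
    at the permuted words symmetrizes the products of V. *)
Lemma symmetrized_expansion (V U : nat -> nat -> K) (phi : seq int -> K) x :
  (forall l l', (l <= n)%N -> (l' <= n)%N ->
     \sum_(k < n.+1) V k l * U k l' = (l == l')%:R) ->
  (m`!)%:R * phi (profile m n x) = \sum_(k : {ffun 'I_m -> 'I_n.+1})
     (\sum_y phi (profile m n y) * \prod_(j < m) U (k j) (y j))
     * symprod (fun j => V (k j)) x.
Proof.
move=> VU.
have e (s : 'S_m) : phi (profile m n x) = \sum_(k : {ffun 'I_m -> 'I_n.+1})
     (\sum_y phi (profile m n y) * \prod_(j < m) U (k j) (y j))
     * \prod_(j < m) V (k (s j)) (x j).
  have -> : profile m n x = profile m n [ffun j => x ((s^-1)%g j)].
    by apply/esym/eqP/eq_profileP; exists (s^-1)%g.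
  rewrite (tensor_inversion V U (fun x => phi (profile m n x))) //.
  apply: eq_bigr => k _; congr (_ * _).
  rewrite [LHS](reindex_inj (@perm_inj _ s)); apply: eq_bigr => j _.
  by rewrite ffunE permK.
rewrite mulr_natl -[m`!]card_Sn -sumr_const (eq_bigr _ (fun s _ => e s)).
by rewrite exchange_big; apply: eq_bigr => k _; rewrite mulr_sumr.
Qed.

End SymmetrizedProduct.

(** * [Hop] and [Delta] in terms of words *)

Section SecondQuantization.
Variable R : realType.
Local Notation C := (R[i]).
Local Notation rC := (@rC R).
Local Notation coord := Defs.coord.
Local Notation addv := Defs.addv.
Local Notation subv := Defs.subv.
Variables (ap am bp bm : R) (m n : nat).
Implicit Types (x : {ffun 'I_m -> 'I_n.+1}) (psi : seq int -> C).
Local Notation profile := (profile m n).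
Local Notation upd := (upd m n).
Local Notation at_exactly := (at_exactly m n).
Local Notation hop_diag := (hop_diag R bp bm n).
Local Notation hop_up := (hop_up R ap n).
Local Notation hop_down := (hop_down R am n).
Local Notation jacobi := (jacobi R ap am bp bm n).
Local Notation weight := (weight R ap am n).

Lemma sum_at_exactly x (i : 'I_n.+1) (c : C) :
  \sum_(j < m | x j == i) c = (at_exactly x i)%:R * c.
Proof.
rewrite natr_sum mulr_suml big_mkcond; apply: eq_bigr => j _.
by rewrite -val_eqE /=; case: eqP => _; rewrite ?mul1r ?mul0r.
Qed.

(** The second quantization made explicit: the factor mu_i - mu_(i+1) counts the particles at site
    i, and moving any one of them leads to the same partition. *)
Lemma Hop_profile psi x : Hop ap am bp bm n m psi (profile x) = \sum_(j < m)
   (hop_diag (x j) * psi (profile x)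
    + hop_up (x j) * psi (profile (upd x j (inord (x j).+1)))
    + hop_down (x j) * psi (profile (upd x j (inord (x j).-1)))).
Proof.
set mu := profile x.
have exactE i : (i <= n)%N -> coord n m mu i - coord n m mu i.+1 = (at_exactly x i)%:Z.
  exact: coord_profileB.
rewrite !big_split /=; congr (_ + _ + _).
- rewrite -mulr_suml; congr (_ * _).
  rewrite -[m%:Z]/(coord n m mu 0) exactE //.
  have -> : coord n m mu n = (at_exactly x n)%:Z.
    by rewrite -exactE // coord_last subr0.
  rewrite /hop_diag rC_real_complex -rmorph_sum; congr (real_complex R _).
  by rewrite big_split /= !sumrMnr -!pmulrn !mulr_natr.
(* The particles are grouped by site; those at site n have no upward move. *)
- rewrite big_add1 big_mkord /= (partition_big x xpredT) //= big_ord_recr /=.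
  rewrite [X in _ = _ + X]big1 ?addr0 => [|j /eqP ->]; last first.
    by rewrite /hop_up ltnn mul0r.
  rewrite big_mkcond; apply: eq_bigr => i _.
  rewrite exactE ?(ltnW (ltn_ord i)) //.
  have upE j : x j == widen_ord (leqnSn n) i ->
      profile (upd x j (inord (x j).+1)) = addv mu (unitv n i.+1).
    move=> /eqP xj.
    by rewrite profile_up inordK xj //= ltnS.
  transitivity (\sum_(j < m | x j == widen_ord (leqnSn n) i)
     rC ((1 - ap) ^+ (i == 0 :> nat)) * psi (addv mu (unitv n i.+1))).
    rewrite sum_at_exactly /=; case: ifP => [_|nin].
      rewrite rC_real_complex rmorphM mulrA [_%:R * _]mulrC; congr (_ * _ * _).
      by rewrite -pmulrn rmorph_nat.
    (* If mu + e_(i+1) lies outside Lambda, site i is empty: moving a particle from it would give a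
       word with exactly this profile. *)
    rewrite (_ : at_exactly x i = 0%N) ?mul0r //.
    apply: big1 => j _; apply/eqP; rewrite eqb0; apply: contraFN nin => xj.
    by rewrite -(upE j) ?profile_in_Lam // -val_eqE.
  by apply: eq_bigr => j xj; rewrite upE // (eqP xj) /hop_up /= ltn_ord.
- rewrite big_add1 big_mkord /= (partition_big x xpredT) //= big_ord_recl /=.
  rewrite [X in _ = X + _]big1 ?add0r => [|j /eqP ->]; last first.
    by rewrite /hop_down mul0r.
  rewrite big_mkcond; apply: eq_bigr => i _.
  rewrite exactE //.
  have downE j : x j == lift ord0 i ->
      profile (upd x j (inord (x j).-1)) = subv mu (unitv n i.+1).
    move=> /eqP xj; rewrite profile_down xj //= inordK //.
    exact: ltnW (ltn_ord i).
  transitivity (\sum_(j < m | x j == lift ord0 i)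
     rC ((1 - am) ^+ (i.+1 == n)) * psi (subv mu (unitv n i.+1))).
    rewrite sum_at_exactly /= subn_eq0 [(n <= _)%N](_ : _ = (i.+1 == n)); last first.
      by rewrite eqn_leq ltn_ord.
    case: ifP => [_|nin].
      rewrite rC_real_complex rmorphM mulrA [_%:R * _]mulrC; congr (_ * _ * _).
      by rewrite -pmulrn rmorph_nat.
    rewrite (_ : at_exactly x i.+1 = 0%N) ?mul0r //.
    apply: big1 => j _; apply/eqP; rewrite eqb0; apply: contraFN nin => xj.
    by rewrite -(downE j) ?profile_in_Lam // -val_eqE.
  by apply: eq_bigr => j xj; rewrite downE // (eqP xj) /hop_down /=.
Qed.

(** A Leibniz rule: the one-particle operator acts on each tensor factor in turn, so the eigenvalues
    add. *)
Lemma Hop_symprod (f : 'I_m -> nat -> C) (e : 'I_m -> C) psi x :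
  (forall i l, (l <= n)%N -> jacobi (f i) l = e i * f i l) ->
  (forall y, psi (profile y) = symprod _ m n f y) ->
  Hop ap am bp bm n m psi (profile x) = (\sum_(i < m) e i) * psi (profile x).
Proof.
move=> fe psiE; rewrite Hop_profile.
transitivity (\sum_(j < m) \sum_(s : 'S_m)
    jacobi (f (s j)) (x j) * \prod_(l < m | l != j) f (s l) (x l)).
  apply: eq_bigr => j _; rewrite !psiE !symprod_upd.
  have -> : symprod _ m n f x =
      \sum_(s : 'S_m) f (s j) (x j) * \prod_(l < m | l != j) f (s l) (x l).
    by apply: eq_bigr => s _; rewrite (bigD1 j).
  rewrite !mulr_sumr -!big_split /=; apply: eq_bigr => s _.
  rewrite /jacobi !mulrDl !mulrA; congr (_ + _ + _).
    (* At site n the argument of [inord] is out of range, but [hop_up] is zero there. *)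
    rewrite /hop_up; case: ltnP => [lt_xn|_]; last by rewrite !mul0r.
    by rewrite inordK.
  rewrite /hop_down; case: posnP => [|x0]; first by rewrite !mul0r.
  by rewrite inordK // ltnS (leq_trans (leq_pred _)) // -ltnS.
rewrite exchange_big psiE /symprod mulr_sumr; apply: eq_bigr => s _.
(* For fixed s the eigenvalues [e (s j)], summed over j, give the sum over all i. *)
rewrite mulr_suml [RHS](reindex_inj (@perm_inj _ s)); apply: eq_bigr => j _.
by rewrite fe -1?ltnS // [in RHS](bigD1 j) //= mulrA.
Qed.

Lemma prod_weight x : \prod_(j < m) weight (x j) =
  ((1 - ap) ^+ at_exactly x 0 * (1 - am) ^+ at_exactly x n)^-1.
Proof.
rewrite /weight prodfV big_split /=; congr (_ * _)^-1.
  by rewrite -(big_morph _ (exprD (1 - ap)) (expr0 _)).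
by rewrite -(big_morph _ (exprD (1 - am)) (expr0 _)).
Qed.

(** [Delta] is the image under [profile] of the product weight on words: its factorials form the
    size of the fibre. *)
Lemma Delta_profile x : Delta ap am n m (profile x) =
  #|[set y | profile y == profile x]|%:R * \prod_(j < m) weight (x j).
Proof.
have hc i : (i <= n)%N ->
    absz (coord n m (profile x) i - coord n m (profile x) i.+1) = at_exactly x i.
  by move=> le_in; rewrite coord_profileB.
rewrite /Delta prod_weight -[m%:Z]/(coord n m (profile x) 0) hc //.
rewrite -[coord n m _ n]subr0 -(coord_last m n (profile x)) hc //.
rewrite (eq_bigr (fun i : 'I_n.+1 => ((at_exactly x i)`!)%:R)); last first.
  by move=> i _; rewrite hc // -ltnS.
rewrite -(card_profile m n x) natrM natr_prod invfM.
set P := \prod_(i < n.+1) _; have P0 : P != 0.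
  by apply/prodf_neq0 => i _; rewrite pnatr_eq0 -lt0n fact_gt0.
by rewrite -mulrA [_^-1 / P]mulrC mulVKf.
Qed.

End SecondQuantization.

(** * Summation over partitions *)

Section LamEnum.
Variables n m : nat.

Lemma mem_lam_enum mu : (mu \in lam_enum n m) = inLam n m mu.
Proof.
rewrite mem_filter andb_idr // => /and3P[/eqP sz _ /allP al].
have szt : size [seq inord (absz x) : 'I_m.+1 | x <- mu] == n by rewrite size_map sz.
apply/mapP; exists (Tuple szt); first by rewrite mem_enum.
rewrite /= -map_comp -[LHS]map_id; apply/eq_in_map => x /al /andP[x0 xm] /=.
by rewrite inordK ?gez0_abs // ltnS -lez_nat gez0_abs.
Qed.

Lemma lam_enum_uniq : uniq (lam_enum n m).
Proof.
rewrite filter_uniq // map_inj_uniq ?enum_uniq // => t u e; apply: val_inj.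
by apply: inj_map e => x y [] /val_inj.
Qed.

Lemma sum_fibers (K : nmodType) (I : finType) (h : I -> seq int) (F : I -> K) :
  (forall k, inLam n m (h k)) ->
  \sum_k F k = \sum_(mu <- lam_enum n m) \sum_(k | h k == mu) F k.
Proof.
move=> hL; under [RHS]eq_bigr => mu _ do rewrite big_mkcond.
rewrite exchange_big; apply: eq_bigr => k _ /=.
rewrite (bigD1_seq (h k)) ?mem_lam_enum ?lam_enum_uniq //= eqxx.
by rewrite big1 ?addr0 // => mu; rewrite eq_sym => /negPf ->.
Qed.
End LamEnum.

(** * The wave functions: eigenvalues, orthogonality, completeness and spectrum *)

Section WaveBasis.
Variable R : realType.
Local Notation C := (R[i]).
Local Notation rC := (@rC R).
Variables (m n : nat) (pp qp pm qm : R) (theta : nat -> R).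
Hypothesis hn : (0 < n)%N.
Hypotheses (hpp : -1 < pp < 1) (hqp : -1 < qp < 1).
Hypotheses (hpm : -1 < pm < 1) (hqm : -1 < qm < 1).
Hypothesis htheta : forall k : nat, (k <= n)%N ->
  0 < theta k < pi /\
  2 * n%:R * theta k + va pp (theta k) + va qp (theta k) + va pm (theta k)
    + va qm (theta k) = 2 * pi * k.+1%:R.
Let ap := pp * qp.
Let am := pm * qm.
Let bp := pp + qp.
Let bm := pm + qm.
Local Notation H := (Hop ap am bp bm n m).
Local Notation profile := (profile m n).
Local Notation word := (word m n).
Local Notation inner1 := (inner1 R ap am n).
Implicit Types (kappa mu : seq int) (x y : {ffun 'I_m -> 'I_n.+1}).

Let mul_lt1 (p q : R) : -1 < p < 1 -> -1 < q < 1 -> p * q < 1.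
Proof.
rewrite -!ltr_norml => hp hq; apply: le_lt_trans (ler_norm _) _.
by rewrite normrM mulr_ilt1.
Qed.

Let hap : ap < 1. Proof. exact: mul_lt1. Qed.
Let ham : am < 1. Proof. exact: mul_lt1. Qed.

Definition wave (k l : nat) : C := Rl ap bp l (theta k).

Lemma wave_real k l : (k <= n)%N -> conjc (wave k l) = wave k l.
Proof. by move=> /htheta[ht _]; apply: conjc_Rl. Qed.

Lemma wave0 k : (k <= n)%N -> wave k 0 = rC (1 - ap).
Proof. by move=> /htheta[ht _]; apply: Rl0. Qed.

Lemma wave0_neq0 k : (k <= n)%N -> wave k 0 != 0.
Proof.
by move=> kn; rewrite wave0 // rC_real_complex fmorph_eq0 gt_eqF // subr_gt0.
Qed.

Lemma jacobi_wave k l : (k <= n)%N -> (l <= n)%N ->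
  jacobi R ap am bp bm n (wave k) l = rC (2 * cos (theta k)) * wave k l.
Proof.
move=> /htheta[ht e] ln; apply: jacobi_Rl => //; by exists k.+1.
Qed.

(** [cos] is injective on [0, pi], and equal roots give equal left-hand sides of the phase equation,
    hence the same k. *)
Lemma theta_inj k k' : (k <= n)%N -> (k' <= n)%N ->
  cos (theta k) = cos (theta k') -> k = k'.
Proof.
move=> /htheta[/andP[t0 tpi] e] /htheta[/andP[t0' tpi'] e'] /cos_inj.
rewrite !in_itv /= !ltW // => /(_ isT isT) et.
have : 2 * pi * k.+1%:R = 2 * pi * k'.+1%:R :> R by rewrite -e -e' et.
have pi2 : 2 * pi != 0 :> R by rewrite mulf_neq0 ?pnatr_eq0 // gt_eqF // pi_gt0.
by move/(mulfI pi2)/eqP; rewrite eqr_nat => /eqP[].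
Qed.

Lemma wave_orthogonal k k' : (k <= n)%N -> (k' <= n)%N -> k != k' ->
  inner1 (wave k) (wave k') = 0.
Proof.
move=> kn kn' kk'.
apply: (eigen_orthogonal _ _ _ bp bm _ hap ham _ _
  (rC (2 * cos (theta k))) (rC (2 * cos (theta k')))).
- apply: contra kk'; rewrite rC_real_complex (inj_eq (fmorph_inj _)) => /eqP.
  have two0 : 2 != 0 :> R by rewrite pnatr_eq0.
  by move/(mulfI two0)/theta_inj => ->.
- by move=> l; apply: jacobi_wave.
- by move=> l; apply: jacobi_wave.
Qed.

Lemma wave_norm k : (k <= n)%N -> inner1 (wave k) (wave k) != 0.
Proof.
move=> kn; rewrite gt_eqF // inner1_gt0 ?wave0_neq0 // => l; exact: wave_real.
Qed.

Definition dual_wave (k l : nat) : C :=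
  rC (weight R ap am n l) * wave k l / inner1 (wave k) (wave k).

(** There are as many waves as sites. By orthogonality the matrix of dual waves is a left inverse of
    the square matrix of waves, hence also a right inverse. *)
Lemma wave_complete l l' : (l <= n)%N -> (l' <= n)%N ->
  \sum_(k < n.+1) wave k l * dual_wave k l' = (l == l')%:R.
Proof.
move=> ln ln'.
pose A : 'M[C]_n.+1 := \matrix_(k, l) dual_wave k l.
pose B : 'M[C]_n.+1 := \matrix_(l, k) wave k l.
have AB : A *m B = 1%:M.
  apply/matrixP => k k'; rewrite !mxE.
  transitivity (inner1 (wave k) (wave k') / inner1 (wave k) (wave k)).
    rewrite /inner1 mulr_suml; apply: eq_bigr => i _; rewrite !mxE /dual_wave.
    by rewrite mulrAC mulrA.
  case: eqVneq => [->|kk']; first by rewrite divff // wave_norm // -ltnS.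
  by rewrite wave_orthogonal ?mul0r // -ltnS.
have /matrixP/(_ (inord l) (inord l')) := mulmx1C AB.
rewrite !mxE -val_eqE /= !inordK // => <-.
by apply: eq_bigr => k _; rewrite !mxE !inordK.
Qed.

Definition part kappa (i : 'I_m) : nat := absz (nth 0 kappa i).

Lemma part_leq kappa i : inLam m n kappa -> (part kappa i <= n)%N.
Proof.
move=> /and3P[/eqP sz _ /allP al].
have /al/andP[k0 kn] : nth 0 kappa i \in kappa by rewrite mem_nth // sz.
by rewrite -lez_nat gez0_abs.
Qed.

Definition waves kappa (i : 'I_m) : nat -> C := wave (part kappa i).

Local Notation psi kappa := (psit ap bp n (xit m theta kappa)).

Lemma psi_word kappa mu : psi kappa mu = symprod _ m n (waves kappa) (word mu).
Proof.
apply: eq_bigr => s _; apply: eq_bigr => j _.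
by rewrite /waves /wave wordE.
Qed.

Lemma psi_profile kappa x : psi kappa (profile x) = symprod _ m n (waves kappa) x.
Proof.
by rewrite psi_word; apply: symprod_profile; rewrite wordK ?profile_in_Lam.
Qed.

Lemma psi_real kappa mu : inLam m n kappa -> conjc (psi kappa mu) = psi kappa mu.
Proof.
move=> hk; rewrite psi_word rmorph_sum; apply: eq_bigr => s _.
by rewrite rmorph_prod; apply: eq_bigr => j _; apply: wave_real; apply: part_leq.
Qed.

(** With all particles at site 0 every wave equals 1 - ap, and the value is m! (1 - ap)^m. *)
Lemma psi_neq0 kappa : inLam m n kappa -> psi kappa (profile [ffun=> ord0]) != 0.
Proof.
move=> hk; rewrite psi_profile /symprod.
rewrite (eq_bigr (fun _ => rC (1 - ap) ^+ m)) => [|s _].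
  rewrite sumr_const card_Sn mulrn_eq0 negb_or -lt0n fact_gt0 expf_neq0 //.
  by rewrite -(wave0 0) // wave0_neq0.
rewrite (eq_bigr (fun _ => rC (1 - ap))) ?prodr_const ?card_ord // => j _.
by rewrite ffunE /waves wave0 // part_leq.
Qed.

Lemma H_psi kappa mu : inLam m n kappa -> inLam n m mu ->
  H (psi kappa) mu = rC (Et (xit m theta kappa)) * psi kappa mu.
Proof.
move=> hk hmu; rewrite -(wordK _ _ _ hmu).
rewrite (Hop_symprod _ _ _ _ _ _ _ (waves kappa)
  (fun i => rC (2 * cos (theta (part kappa i))))) //.
- by rewrite rC_real_complex -rmorph_sum -mulr_sumr.
- by move=> i l ln; rewrite jacobi_wave // part_leq.
- exact: psi_profile.
Qed.

(** Passing to words replaces [Delta] by a product weight, for which sums of tensor products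
    factorize. *)
Lemma inner_words (f g : seq int -> C) : inner ap am n m f g =
  \sum_x f (profile x) * conjc (g (profile x))
    * \prod_(j < m) rC (weight R ap am n (x j)).
Proof.
rewrite (sum_fibers n m _ _ profile) => [|x]; last exact: profile_in_Lam.
rewrite /inner big_seq [RHS]big_seq; apply: eq_bigr => mu.
rewrite mem_lam_enum => hmu; rewrite -{1 2 3}(wordK _ _ _ hmu) Delta_profile.
set y := word mu.
rewrite (eq_bigr (fun=> f (profile y) * conjc (g (profile y))
    * \prod_(j < m) rC (weight R ap am n (y j)))).
  rewrite (eq_bigl (fun x => x \in [set x | profile x == profile y])) => [|x].
    rewrite sumr_const -[RHS]mulr_natl rC_real_complex rmorphM rmorph_nat rmorph_prod.
    by rewrite mulrCA.
  by rewrite inE /y wordK.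
move=> x /eqP xmu.
have xy : profile x = profile y by rewrite /y wordK.
rewrite xy; congr (_ * _); rewrite rC_real_complex -!rmorph_prod !prod_weight.
by rewrite !(profile_at_exactly _ _ _ _ _ xy).
Qed.

(** A partition is determined by the multiset of its parts; here [s^-1 * t] matches the two
    multisets. *)
Lemma eq_part kappa kappa' (s t : 'S_m) : inLam m n kappa -> inLam m n kappa' ->
  (forall j, part kappa (s j) = part kappa' (t j)) -> kappa = kappa'.
Proof.
move=> /and3P[sz srt /allP al] /and3P[sz' srt' /allP al'] e.
apply: (sorted_eq _ _ srt srt').
- by move=> a b c ab bc; apply: le_trans bc ab.
- by move=> a b; rewrite andbC; apply: le_anti.
apply/(@tuple_permP _ _ _ (Tuple sz')); exists (s^-1 * t)%g.
apply: (@eq_from_nth _ 0); rewrite ?size_tuple (eqP sz) // => l lm.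
rewrite -[l]/(nat_of_ord (Ordinal lm)) -tnth_nth tnth_mktuple permM (tnth_nth 0) /=.
have pos r (h : size r == m) (hr : forall a, a \in r -> 0 <= a <= n%:Z) (j : 'I_m) :
    nth 0 r j = (part r j)%:Z.
  have /hr/andP[r0 _] : nth 0 r j \in r by rewrite mem_nth // (eqP h).
  by rewrite /part gez0_abs.
by rewrite (pos kappa' sz' al') -e permKV -(pos kappa sz al).
Qed.

(** For each pair of permutations in the expanded product some particle carries two different
    indices, and its one-particle inner product vanishes. *)
Lemma psi_orthogonal kappa kappa' : inLam m n kappa -> inLam m n kappa' ->
  kappa != kappa' -> inner ap am n m (psi kappa) (psi kappa') = 0.
Proof.
move=> hk hk' kk'; rewrite inner_words.
under eq_bigr => x _ do rewrite psi_real // !psi_profile.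
rewrite (sum_symprod2 _ _ _ _ _ (fun l => rC (weight R ap am n l))).
apply: big1 => s _; apply: big1 => t _.
have [j ne] : exists j, part kappa (s j) != part kappa' (t j).
  apply/existsP; apply: contraNT kk' => /existsPn e; apply/eqP.
  by apply: (@eq_part _ _ s t) => // j; apply/eqP; move: (e j); rewrite negbK.
by rewrite (bigD1 j) //= -/(inner1 _ _) wave_orthogonal ?mul0r // part_leq.
Qed.

Lemma psi_norm kappa : inLam m n kappa ->
  inner ap am n m (psi kappa) (psi kappa) != 0.
Proof.
move=> hk; rewrite inner_words gt_eqF // (bigD1 [ffun=> ord0]) //=.
have w0 x : 0 < \prod_(j < m) rC (weight R ap am n (x j)).
  by apply: prodr_gt0 => j _; rewrite rC_real_complex ltcR weight_gt0.
apply: ltr_pwDl; last first.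
  apply: sumr_ge0 => x _; apply: mulr_ge0; first exact: mulcJ_ge0.
  by rewrite ltW.
by rewrite mulr_gt0 // lt_def mulcJ_ge0 mulf_neq0 ?conjc_eq0 ?psi_neq0.
Qed.

(** The representative in Lambda of a multi-index k up to permutation; the symmetrized product of
    the waves [k j] depends on it alone. *)
Definition sorted_parts (k : {ffun 'I_m -> 'I_n.+1}) : seq int :=
  sort (fun a b : int => b <= a) [tuple (k j)%:Z | j < m].

Lemma sorted_parts_in_Lam k : inLam m n (sorted_parts k).
Proof.
rewrite /inLam size_sort size_tuple eqxx sort_sorted /=; last first.
  by move=> a b; exact: le_total.
by rewrite all_sort; apply/allP => _ /mapP[j _ ->]; rewrite !lez_nat /= leq_ord.
Qed.

Lemma part_sorted_parts k :
  exists s : 'S_m, forall j, part (sorted_parts k) j = k (s j).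
Proof.
have /tuple_permP[s e] : perm_eq (sorted_parts k) [tuple (k j)%:Z | j < m].
  by rewrite perm_sort.
by exists s => j; rewrite /part e -tnth_nth !tnth_mktuple.
Qed.

Lemma psi_span (phi : seq int -> C) : exists c : seq int -> C,
  forall mu, inLam n m mu ->
    phi mu = \sum_(kappa <- lam_enum m n) c kappa * psi kappa mu.
Proof.
pose a (k : {ffun 'I_m -> 'I_n.+1}) : C :=
  \sum_y phi (profile y) * \prod_(j < m) dual_wave (k j) (y j).
(* The tensor coefficients of all k that sort to kappa are collected; 1/m! cancels the factor of the
   symmetrized expansion. *)
exists (fun kappa => (m`!)%:R^-1 * \sum_(k | sorted_parts k == kappa) a k).
move=> mu hmu; rewrite -(wordK _ _ _ hmu); set x := word mu.
have m0 : (m`!)%:R != 0 :> C by rewrite pnatr_eq0 -lt0n fact_gt0.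
apply: (mulfI m0); rewrite mulr_sumr.
rewrite (symmetrized_expansion _ _ _ wave dual_wave) => [|l l']; last first.
  exact: wave_complete.
rewrite (sum_fibers m n _ _ sorted_parts) => [|k]; last exact: sorted_parts_in_Lam.
apply: eq_bigr => kappa _; rewrite mulrA mulVKf // mulr_suml.
apply: eq_bigr => k /eqP <-; congr (_ * _); rewrite psi_profile.
have [s es] := part_sorted_parts k.
rewrite -(symprod_perml _ _ _ (fun j => wave (k j)) x s).
by apply: eq_bigr => t _; apply: eq_bigr => j _; rewrite /waves es.
Qed.

(** Every partition reached in [Hop_profile] is again a profile, so [H] sees only values on
    Lambda. *)
Lemma eq_H (f g : seq int -> C) : (forall mu, inLam n m mu -> f mu = g mu) ->
  forall mu, inLam n m mu -> H f mu = H g mu.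
Proof.
move=> e mu hmu; rewrite -(wordK _ _ _ hmu) !Hop_profile //.
by apply: eq_bigr => j _; rewrite !e ?profile_in_Lam.
Qed.

Lemma H_sum (c : seq int -> C) (f : seq int -> seq int -> C) r mu : inLam n m mu ->
  H (fun nu => \sum_(kappa <- r) c kappa * f kappa nu) mu
  = \sum_(kappa <- r) c kappa * H (f kappa) mu.
Proof.
move=> hmu; rewrite -(wordK _ _ _ hmu) !Hop_profile //.
under [RHS]eq_bigr => kappa _ do rewrite Hop_profile // mulr_sumr.
rewrite exchange_big; apply: eq_bigr => j _.
rewrite !mulr_sumr -!big_split; apply: eq_bigr => kappa _ /=.
by ring.
Qed.

Lemma H_sub_sum (c : seq int -> C) z mu : inLam n m mu ->
  let f nu := \sum_(kappa <- lam_enum m n) c kappa * psi kappa nu in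
  H f mu - z * f mu = \sum_(kappa <- lam_enum m n)
    c kappa * (rC (Et (xit m theta kappa)) - z) * psi kappa mu.
Proof.
move=> hmu f; rewrite H_sum // mulr_sumr -sumrB big_seq [RHS]big_seq.
apply: eq_bigr => kappa; rewrite mem_lam_enum => hk; rewrite H_psi //.
by ring.
Qed.

(** Pairing the relation with [psi kappa] isolates [c kappa] times a nonzero norm. *)
Lemma psi_free (c : seq int -> C) :
  (forall mu, inLam n m mu ->
     \sum_(kappa <- lam_enum m n) c kappa * psi kappa mu = 0) ->
  forall kappa, inLam m n kappa -> c kappa = 0.
Proof.
move=> e kappa hk.
pose f mu := \sum_(k <- lam_enum m n) c k * psi k mu.
have : inner ap am n m f (psi kappa) = 0.
  rewrite /inner big_seq big1 // => mu; rewrite mem_lam_enum => hmu.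
  by rewrite /f e // !mul0r.
have -> : inner ap am n m f (psi kappa) = \sum_(k <- lam_enum m n) c k * inner ap am n m (psi k) (psi kappa).
  rewrite /inner; under [RHS]eq_bigr => k _ do rewrite mulr_sumr.
  rewrite exchange_big; apply: eq_bigr => mu _; rewrite /f !mulr_suml.
  by apply: eq_bigr => k _; rewrite !mulrA.
rewrite (bigD1_seq kappa) ?mem_lam_enum ?lam_enum_uniq //= big_seq_cond big1 ?addr0.
  by move/eqP; rewrite mulf_eq0 (negPf (psi_norm _ hk)) orbF => /eqP.
by move=> k /andP[]; rewrite mem_lam_enum => hk' kk; rewrite psi_orthogonal ?mulr0.
Qed.

(** At an energy, [psi kappa] is a nonzero element of the kernel of H - z. Away from the energies, H
    - z is diagonal in the basis with nonzero entries, hence bijective. *)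
Lemma spectrum_H z : in_spectrum ap am bp bm n m z <->
  exists kappa, inLam m n kappa /\ z = rC (Et (xit m theta kappa)).
Proof.
split=> [spec|[kappa [hk ->]] [_ inj]]; last first.
  have := psi_neq0 _ hk; rewrite inj ?eqxx ?profile_in_Lam // => mu hmu.
  by rewrite H_psi // subrr.
apply: contrapT => nex; apply: spec.
have ne kappa : inLam m n kappa -> rC (Et (xit m theta kappa)) - z != 0.
  by move=> hk; rewrite subr_eq0; apply/eqP => e; apply: nex; exists kappa.
split=> [phi|f f0].
  have [c ce] := psi_span phi.
  (* The resolvent in the eigenbasis: each coefficient of phi is divided by its E - z. *)
  exists (fun nu => \sum_(kappa <- lam_enum m n)
    c kappa / (rC (Et (xit m theta kappa)) - z) * psi kappa nu) => mu hmu.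
  rewrite (H_sub_sum (fun kappa => c kappa / _)) // ce // big_seq [RHS]big_seq.
  by apply: eq_bigr => kappa; rewrite mem_lam_enum => /ne ?; rewrite divfK.
have [c ce] := psi_span f.
suff c0 kappa : inLam m n kappa -> c kappa = 0.
  move=> mu hmu; rewrite ce // big_seq big1 // => kappa.
  by rewrite mem_lam_enum => /c0 ->; rewrite mul0r.
move=> hk; apply: (mulIf (ne _ hk)); rewrite mul0r.
apply: (psi_free (fun kappa =>
  c kappa * (rC (Et (xit m theta kappa)) - z))) => // mu hmu.
by rewrite -H_sub_sum //= -(eq_H _ _ ce) // -ce // f0.
Qed.

End WaveBasis.

Theorem theorem5p1 (R : realType) (m n : nat) (pp qp pm qm : R)
  (hn : (0 < n)%N)
  (hpp : -1 < pp < 1) (hqp : -1 < qp < 1) (hpm : -1 < pm < 1) (hqm : -1 < qm < 1)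
  (theta : nat -> R)
  (htheta : forall k : nat, (k <= n)%N ->
     0 < theta k < pi /\
     2 * n%:R * theta k + va pp (theta k) + va qp (theta k) + va pm (theta k)
       + va qm (theta k) = 2 * pi * k.+1%:R) :
  let ap := pp * qp in let am := pm * qm in
  let bp := pp + qp in let bm := pm + qm in
  let psi := fun kappa : seq int => psit ap bp n (xit m theta kappa) in
  (* (i) spectrum *)
  (forall z : R[i], in_spectrum ap am bp bm n m z <->
     exists kappa, inLam m n kappa /\ z = rC (Et (xit m theta kappa)))
  (* (ii) eigenfunctions *)
  /\ (forall kappa, inLam m n kappa ->
        forall mu, inLam n m mu ->
          Hop ap am bp bm n m (psi kappa) mu = rC (Et (xit m theta kappa)) * psi kappa mu)
  (* (ii) orthogonal basis: nonzero vectors ... *)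
  /\ (forall kappa, inLam m n kappa -> exists2 mu, inLam n m mu & psi kappa mu != 0)
  (* ... pairwise orthogonal ... *)
  /\ (forall kappa kappa', inLam m n kappa -> inLam m n kappa' -> kappa != kappa' ->
        inner ap am n m (psi kappa) (psi kappa') = 0)
  (* ... and spanning l^2(Lambda^{(n,m)}, Delta). *)
  /\ (forall phi : seq int -> R[i], exists c : seq int -> R[i],
        forall mu, inLam n m mu ->
          phi mu = \sum_(kappa <- lam_enum m n) c kappa * psi kappa mu).
Proof.
move=> ap am bp bm psi; split; last split; last split; last split.
- exact: spectrum_H.
- by move=> kappa hk mu hmu; exact: H_psi.
- move=> kappa hk; exists (profile m n [ffun=> ord0]); first exact: profile_in_Lam.
  exact: (psi_neq0 _ _ _ _ _ pm qm theta).
- by move=> kappa kappa' hk hk'; exact: psi_orthogonal.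
- exact: (psi_span _ _ _ pp qp pm qm theta).
Qed.
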